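(* Let $d$, $n$, $r$ be positive integers with $\gcd(d,n)=1$ and $n$ odd. Let $s$ be an integer with $0\leqslant s\leqslant n-1$ and $s\equiv \langle -r/d\rangle_n+1\pmod 2$. Then $$ \sum_{k=s}^{n-1}\frac{(aq^r;q^d)_k\,(bq^{d-r};q^d)_k\,(q^d;q^{2d})_k\, q^{dk}}{(q^d;q^d)_{k-s}\,(q^d;q^d)_{k+s}\,(abq^{2d};q^{2d})_k} \equiv 0 \pmod{(1-aq^{r+d\langle -r/d\rangle_n})(1-bq^{d-r+d\langle (r-d)/d\rangle_n})}. $$
   Context: $a,b,q$ are indeterminates. The $q$-shifted factorial is $(x;q)_0=1$ and $(x;q)_m=(1-x)(1-xq)\cdots(1-xq^{m-1})$ for $m\geqslant1$. For a rational number $x$ and a positive integer $m$ such that the denominator of $x$ is coprime to $m$, $\langle x\rangle_m$ denotes the least non-negative residue of $x$ modulo $m$. For rational functions $A,B$ and a polynomial $P$ (in the indeterminates involved), $A\equiv B\pmod P$ means that $A-B=P\cdot C/D$ for polynomials $C,D$ with $D$ coprime to $P$. *)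

(* Defs.v *)
From HB Require Import structures.
From mathcomp Require Import all_boot all_order all_algebra.
Set Implicit Arguments. Unset Strict Implicit. Unset Printing Implicit Defensive.
Import Order.TTheory GRing.Theory Num.Theory.
Local Open Scope ring_scope.

(* Polynomial ring Q[a,b,q] realised as {poly {poly {poly rat}}}:
   a is the outermost variable, b the middle one, q the innermost one. *)
Definition Pabq := {poly {poly {poly rat}}}.
Definition Fabq := {fraction Pabq}.

Definition pa : Pabq := 'X.
Definition pb : Pabq := ('X)%:P.
Definition pq : Pabq := ('X)%:P%:P.

Definition fa : Fabq := tofrac pa.
Definition fb : Fabq := tofrac pb.
Definition fq : Fabq := tofrac pq.

Definition qpoch {R : comNzRingType} (x q : R) (m : nat) : R :=
  \prod_(i < m) (1 - x * q ^+ i).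

Definition pdivides (E P : Pabq) : Prop := exists F : Pabq, P = E * F.
Definition pcoprime (D P : Pabq) : Prop :=
  forall E : Pabq, pdivides E D -> pdivides E P -> E \is a GRing.unit.

Definition congr_mod (A B : Fabq) (P : Pabq) : Prop :=
  exists C D : Pabq, D != 0 /\ pcoprime D P /\
    A - B = tofrac P * tofrac C / tofrac D.

(* <x>_m : least non-negative residue of the rational x modulo m, i.e.
   the least t in [0, m) with m dividing the numerator of x - t
   (meaningful when the denominator of x is coprime to m). *)
Definition lnres (x : rat) (m : nat) : nat :=
  nth 0%N [seq t <- iota 0 m | (m%:Z %| numq (x - t%:R))%Z] 0.

(* The polynomial 1 - c q^e for e >= 0; for e < 0 (Laurent case) we use
   the associate q^{-e} - c (= q^{-e} (1 - c q^e), q being a unit). *)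
Definition onemq (c : Pabq) (e : int) : Pabq :=
  match e with
  | Posz m => 1 - c * pq ^+ m
  | Negz m => pq ^+ m.+1 - c
  end.

(* Main.v *)
Require Import Defs.
From HB Require Import structures.
From mathcomp Require Import all_boot all_order all_algebra.
From mathcomp Require Import ring zify.
Import Order.TTheory GRing.Theory Num.Theory.
Local Open Scope ring_scope.

(** Put [p = q^d], [x = a q^r], [y = b q^(d-r)]: the summand is symmetric in [x]
    and [y].  Let [alpha], [beta] be the two residues; then
    [alpha + beta = n - 1] is even, so both have parity opposite to [s].
    The two factors of the modulus generate the kernels of the specialisations
    [x = p^(-alpha)] and [y = p^(-beta)], and at [x = p^(-N)] with [N + s] odd
    the sum is a terminating q-Watson sum that vanishes: a WZ-type recurrence
    relates its values at [N] and [N - 2], down to [N < s], where every term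
    is zero.  The denominators survive both specialisations, so the common
    numerator lies in both prime ideals, and the common denominator in
    neither. *)

(** * Shifted factorials *)

Section Qpoch.
Variable R : comNzRingType.
Implicit Types x q : R.

Lemma qpochSr x q m : qpoch x q m.+1 = qpoch x q m * (1 - x * q ^+ m).
Proof. by rewrite /qpoch big_ord_recr. Qed.

Lemma qpochSl x q m : qpoch x q m.+1 = (1 - x) * qpoch (x * q) q m.
Proof.
rewrite /qpoch big_ord_recl expr0 mulr1; congr (_ * _).
by apply: eq_bigr => i _; rewrite /bump /= exprS mulrA.
Qed.

Lemma qpoch_shift x q m :
  (1 - x) * qpoch (x * q) q m = qpoch x q m * (1 - x * q ^+ m).
Proof. by rewrite -qpochSl qpochSr. Qed.

Lemma qpoch_eq0 x q i m : (i < m)%N -> x * q ^+ i = 1 -> qpoch x q m = 0.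
Proof.
by move=> lt_im xq1; rewrite /qpoch (bigD1 (Ordinal lt_im)) //= xq1 subrr mul0r.
Qed.

End Qpoch.

Lemma qpoch_neq0 (R : idomainType) (x q : R) m :
  (forall i, x * q ^+ i != 1) -> qpoch x q m != 0.
Proof.
by move=> xq; rewrite /qpoch prodf_seq_neq0; apply/allP=> i _;
   rewrite subr_eq0 eq_sym xq.
Qed.

Lemma rmorph_qpoch (R S : comNzRingType) (f : {rmorphism R -> S}) x q m :
  f (qpoch x q m) = qpoch (f x) (f q) m.
Proof.
rewrite /qpoch rmorph_prod; apply: eq_bigr => i _.
by rewrite rmorphB rmorph1 rmorphM rmorphXn.
Qed.

(** * The terminating q-Watson sum *)

Definition wterm {L : fieldType} (p x y : L) (s k : nat) : L :=
  qpoch x p k * qpoch y p k * qpoch p (p ^+ 2) k * p ^+ k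
  / (qpoch p p (k - s) * qpoch p p (k + s) * qpoch (x * y * p) (p ^+ 2) k).

Lemma wtermC (L : fieldType) (p x y : L) s k : wterm p x y s k = wterm p y x s k.
Proof. by rewrite /wterm [x * y]mulrC [qpoch x p k * _]mulrC. Qed.

Section Watson.
Variables (L : fieldType) (p y : L) (s : nat).
Hypotheses (p0 : p != 0) (pX : forall i, p ^+ i.+1 != 1).

(* The multiplier of [wterm] is chosen so that, with [K = p^k], the recurrence
   becomes an identity between quadratic polynomials in [K]. *)
Definition wcert (v : L) k :=
  v / p ^+ k * (1 - p ^+ (k - s)) * (1 - p ^+ (k + s)) * wterm p v y s k.

(** The factor on the left is free of [k], so summation telescopes the certificate and ties the sum
    at [v] to the sum at [v * p ^+ 2]; for v = p^(-N) this passes from N to N - 2. *)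
Lemma wterm_rec (v : L) k : (s <= k)%N -> (forall i, v * y * p ^+ i.+1 != 1) ->
  (1 - v * p ^+ s) * (1 - v / p ^+ s) * wterm p v y s k =
  (1 - v * y) * (1 - v) * (1 - v * p) / (1 - v * y * p) * wterm p (v * p ^+ 2) y s k
  - (wcert v k.+1 - wcert v k).
Proof.
move=> /subnKC <-; move: (k - s)%N => {k} j vyp.
rewrite /wcert /wterm.
have -> : ((s + j).+1 - s = j.+1)%N by lia.
have -> : (s + j - s = j)%N by lia.
rewrite !addSn !qpochSr.
set k := (s + j)%N.
(* [EA] and [EH] bring the factorials at [v * p ^+ 2] back to those at [v], leaving a rational
   identity in powers of [p]. *)
have EA : (1 - v) * (1 - v * p) * qpoch (v * p ^+ 2) p k
   = qpoch v p k * (1 - v * p ^+ k) * (1 - v * p * p ^+ k).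
  have -> : v * p ^+ 2 = v * p * p by ring.
  rewrite -mulrA qpoch_shift mulrA qpoch_shift; ring.
have EH : (1 - v * y * p) * qpoch (v * p ^+ 2 * y * p) (p ^+ 2) k
   = qpoch (v * y * p) (p ^+ 2) k * (1 - v * y * p * (p ^+ 2) ^+ k).
  have -> : v * p ^+ 2 * y * p = v * y * p * p ^+ 2 by ring.
  by rewrite qpoch_shift.
have n1 : 1 - v * y * p != 0.
  by rewrite subr_eq0 eq_sym; have := vyp 0; rewrite expr1.
have nH m : qpoch (v * y * p) (p ^+ 2) m != 0.
  by apply: qpoch_neq0 => i; rewrite -exprM -[_ * p * _]mulrA -exprS vyp.
have nH1 := nH k.+1.
move: nH1; rewrite qpochSr mulf_eq0 negb_or => /andP[nHk nk].
have nH2 : qpoch (v * p ^+ 2 * y * p) (p ^+ 2) k != 0.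
  have : (1 - v * y * p) * qpoch (v * p ^+ 2 * y * p) (p ^+ 2) k != 0.
    by rewrite EH mulf_neq0.
  by rewrite mulf_eq0 negb_or => /andP[].
have npp m : qpoch p p m != 0.
  by apply: qpoch_neq0 => i; rewrite -exprS.
have n1p i : 1 - p * p ^+ i != 0 by rewrite -exprS subr_eq0 eq_sym.
have E2 : (1 - v * y) * (1 - v) * (1 - v * p) / (1 - v * y * p) *
  (qpoch (v * p ^+ 2) p k * qpoch y p k * qpoch p (p ^+ 2) k * p ^+ k /
   (qpoch p p j * qpoch p p (k + s) * qpoch (v * p ^+ 2 * y * p) (p ^+ 2) k))
 = (1 - v * y) * (qpoch v p k * (1 - v * p ^+ k) * (1 - v * p * p ^+ k))
   * (qpoch y p k * qpoch p (p ^+ 2) k * p ^+ k) /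
   (qpoch p p j * qpoch p p (k + s)
    * (qpoch (v * y * p) (p ^+ 2) k * (1 - v * y * p * (p ^+ 2) ^+ k))).
  rewrite -EA -EH; field.
  by rewrite n1 nH2 !npp.
rewrite E2 {E2 EA EH nH2}.
have Eks : p ^+ (k + s) = p ^+ s * p ^+ s * p ^+ j.
  by rewrite -!exprD; congr (_ ^+ _); rewrite /k; lia.
have E2k : (p ^+ 2) ^+ k = p ^+ s * p ^+ s * (p ^+ j * p ^+ j).
  by rewrite -exprM -!exprD; congr (_ ^+ _); rewrite /k; lia.
have Ek : p ^+ k = p ^+ s * p ^+ j by rewrite -exprD.
move: nk (n1p (k + s)%N) (n1p j).
rewrite (exprS p k) (exprS p j) (exprS p (k + s)) Eks E2k Ek => nk m1 m2.
field.
by rewrite nHk nk m1 m2 p0 !expf_neq0 ?npp.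
Qed.

Lemma sum_wterm_odd (N M : nat) (v : L) :
  odd (N + s) -> (N < M)%N -> v * p ^+ N = 1 ->
  (forall i, v * y * p ^+ i.+1 != 1) ->
  \sum_(s <= k < M) wterm p v y s k = 0.
Proof.
elim/ltn_ind: N v => N IH v oddNs ltNM vN vyp.
have wt0 w k m : (m < k)%N -> w * p ^+ m = 1 -> wterm p w y s k = 0.
  by move=> ltmk wm; rewrite /wterm (qpoch_eq0 _ _ _ m) // !mul0r.
have [ltNs|leNs] := ltnP N s.
  rewrite big_nat big1 // => k /andP[lesk _].
  by apply: (wt0 _ _ N) => //; apply: leq_trans lesk.
have ltsN : (s < N)%N.
  rewrite ltn_neqAle leNs andbT; apply: contraTneq oddNs => ->.
  by rewrite addnn odd_double.
(* Since v = p^(-N), the two multipliers are 1 - p^(s-N) and 1 - p^(-N-s), nonzero because s < N. *)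
have nz1 : 1 - v * p ^+ s != 0.
  rewrite subr_eq0 eq_sym; apply: contra_eq_neq vN => vs.
  rewrite -(subnKC ltsN) addSn -addnS exprD mulrA vs mul1r; exact: pX.
have nz2 : 1 - v / p ^+ s != 0.
  rewrite subr_eq0 eq_sym; apply: contra_eq_neq vN => vs.
  have -> : v = p ^+ s.
    by apply: (mulIf (invr_neq0 (expf_neq0 s p0))); rewrite vs divff ?expf_neq0.
  rewrite -exprD addnC; case: N ltsN {IH oddNs ltNM leNs} => // m _; exact: pX.
apply: (mulfI (mulf_neq0 nz1 nz2)); rewrite mulr0 big_distrr /=.
under eq_big_nat => k /andP[lesk _] do rewrite wterm_rec //.
rewrite sumrB telescope_sumr; last by apply: ltnW; apply: ltn_trans ltNM.
(* Both boundary certificates vanish: the upper one since M > N, the lower one through its factor 1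
   - p^(s-s). *)
rewrite {1}/wcert (wt0 _ M N) // mulr0 sub0r opprK.
rewrite {1}/wcert subnn expr0 subrr mulr0 !mul0r addr0 -big_distrr /=.
(* For N = 1 there is no N - 2, but then the coefficient contains 1 - v p = 0. *)
case: N ltsN IH oddNs ltNM vN {leNs} => [//|[|N]] ltsN IH oddNs ltNM vN.
  by rewrite -[v * p]/(v * p ^+ 1) vN subrr mulr0 !mul0r.
rewrite (IH N) ?mulr0 //.
- by move: oddNs; rewrite !addSn /= negbK.
- by apply: ltn_trans ltNM.
- by rewrite -mulrA -exprD add2n.
- move=> i; have -> : v * p ^+ 2 * y * p ^+ i.+1 = v * y * p ^+ i.+3.
    by rewrite -[i.+3]add2n exprD; ring.
  exact: vyp.
Qed.

End Watson.

(** * Least residues of fractions *)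

(** Reducing z/d cancels only a divisor of [d], which is coprime to [n]. *)
Lemma dvdz_numq_div (z : int) (d n : nat) : (0 < d)%N -> coprime d n ->
  (n%:Z %| numq (z%:Q / d%:Q))%Z = (n%:Z %| z)%Z.
Proof.
move=> d_gt0.
have : (d%:Z != 0) by rewrite eqz_nat -lt0n.
rewrite -[coprime d n]/(coprimez d n) coprimez_sym.
case: divqP => // k x k0 _; rewrite coprimezMr => /andP[cnk _].
by rewrite mulrC Gauss_dvdzl.
Qed.

Lemma lnresP (z : int) (d n : nat) : (0 < d)%N -> (0 < n)%N -> coprime d n ->
  let t := lnres (z%:Q / d%:Q) n in
  (t < n)%N /\ (n%:Z %| d%:Z * t%:Z - z)%Z.
Proof.
move=> d_gt0 n_gt0 cdn t.
set x := z%:Q / d%:Q.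
have res_dvd u : (n%:Z %| numq (x - u%:R))%Z = (n%:Z %| d%:Z * u%:Z - z)%Z.
  have -> : x - u%:R = (z - d%:Z * u%:Z)%:Q / d%:Q.
    have dn0 : d%:Q != 0 by rewrite intr_eq0 eqz_nat -lt0n.
    by rewrite rmorphB rmorphM /= mulrBl [_ * u%:Q]mulrC mulfK.
  by rewrite dvdz_numq_div // -opprB rpredN.
set S := [seq u <- iota 0 n | (n%:Z %| numq (x - u%:R))%Z].
(* If [S] is nonempty, [nth] returns a member of it and not its default 0. *)
suff : t \in S by rewrite mem_filter res_dvd mem_iota => /and3P[].
apply: mem_nth; rewrite size_filter -has_count; apply/hasP.
have n0 : n%:Z != 0 by rewrite eqz_nat -lt0n.
have /coprimezP[[u v] /= uv] : coprimez d n by [].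
(* By Bezout [u] inverts [d] modulo [n], so z u solves d t = z modulo [n]. *)
exists `|(z * u %% n)%Z|%N.
  rewrite mem_iota add0n /= -ltz_nat gez0_abs ?modz_ge0 //.
  by apply: ltz_pmod; rewrite ltz_nat.
rewrite res_dvd gez0_abs ?modz_ge0 // /modz.
apply/dvdzP; exists (- (d%:Z * (z * u %/ n)%Z) - z * v).
apply/eqP; rewrite -subr_eq0; apply/eqP.
by transitivity (z * (u * d + v * n) - z); [ring | rewrite uv mulr1 subrr].
Qed.

(* [N] does not depend on [f]: it serves for [tofrac] and for the
   specialisations alike. *)
Lemma sum_common_denominator (R : comNzRingType) (num den : nat -> R)
    (r : seq nat) :
  exists N : R, forall (L : fieldType) (f : {rmorphism R -> L}),
    (forall k, f (den k) != 0) ->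
    \sum_(k <- r) f (num k) / f (den k) = f N / f (\prod_(k <- r) den k).
Proof.
elim: r => [|k r [N IH]].
  by exists 0 => L f _; rewrite !big_nil rmorph0 mul0r.
exists (num k * \prod_(j <- r) den j + N * den k) => L f nz.
rewrite !big_cons IH // rmorphD !rmorphM addf_div //.
by rewrite rmorph_prod prodf_seq_neq0; apply/allP=> j _; rewrite nz.
Qed.

(** * Kernel of evaluation at an inverse *)

Section LinearKernel.
Variables (A : idomainType) (u : A).

(* ['X] inverts [u] modulo [1 - 'X * u%:P], so Gauss's lemma is not needed. *)
Lemma mul_exp_mod_linear (f : {poly A}) : exists k (g : {poly A}) (c : A),
  (u ^+ k)%:P * f = (1 - 'X * u%:P) * g + c%:P.
Proof.
elim/poly_ind: f => [|f c [k [g [c0 IH]]]].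
  by exists 0%N, 0, 0; rewrite !mulr0 addr0.
exists k.+1, (u%:P * 'X * g - c0%:P), (c0 + u ^+ k.+1 * c).
rewrite mulrDr exprS !polyCM polyCD polyCM polyCM.
have -> : u%:P * (u ^+ k)%:P * (f * 'X) = u%:P * 'X * ((u ^+ k)%:P * f).
  by ring.
rewrite IH; ring.
Qed.

Lemma linear_kernel (f : {poly A}) (w : {fraction A}) :
  tofrac u * w = 1 -> (map_poly (@tofrac A) f).[w] = 0 ->
  exists g, f = (1 - 'X * u%:P) * g.
Proof.
move=> uw1 fw0; have [k [g [c E]]] := mul_exp_mod_linear f.
have : (map_poly (@tofrac A) ((u ^+ k)%:P * f)).[w] = 0.
  by rewrite rmorphM hornerM fw0 mulr0.
rewrite E rmorphD rmorphM rmorphB rmorph1 rmorphM /= !map_polyC map_polyX /=.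
rewrite !hornerE mulrC [w * _]mulrC uw1 subrr mulr0 add0r => /eqP.
rewrite tofrac_eq0 => /eqP c0; move: E; rewrite c0 polyC0 addr0 => E.
(* With T = 'X u, multiply 1 = T^k + (1 - T)(1 + T + ... + T^(k-1)) by [f], and use that u^k f = (1
   - T) g. *)
exists ('X ^+ k * g + (\sum_(i < k) ('X * u%:P) ^+ i) * f).
rewrite mulrDr mulrCA -E [X in _ = _ + X]mulrA.
have -> : (1 - 'X * u%:P) * (\sum_(i < k) ('X * u%:P) ^+ i)
    = 1 - ('X * u%:P) ^+ k.
  by rewrite -[LHS]opprK -mulNr opprB -subrX1 opprB.
rewrite exprMn polyC_exp; ring.
Qed.

End LinearKernel.

(** * The specialisations of a and of b *)

Definition Pbq := {poly {poly rat}}.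
Definition Fbq := {fraction Pbq}.
Definition tb : Fbq := tofrac ('X : Pbq).
Definition tq : Fbq := tofrac (('X)%:P : Pbq).

(** The target is a field, so that q^(-e) exists for either sign of [e]. *)
Definition spec_a (e : int) : {rmorphism Pabq -> Fbq} :=
  horner_morph (f := @tofrac Pbq) (u := tq ^ (- e)) (fun x => mulrC _ _).

(** After the swap the surviving indeterminate a is sent to [tb], so both specialisations share one
    target and one pair [tb], [tq]. *)
Definition spec_b (e : int) : {rmorphism Pabq -> Fbq} :=
  spec_a e \o (@swapXY _ : Pabq -> Pabq).

Lemma tq_neq0 : tq != 0.
Proof. by rewrite tofrac_eq0 polyC_eq0 polyX_eq0. Qed.

Lemma tqX_neq1 i : tq ^+ i.+1 != 1.
Proof.
rewrite -tofracXn -tofrac1 tofrac_eq -polyC_exp -polyC1 (inj_eq polyC_inj).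
by apply/eqP => /(congr1 (fun p : {poly rat} => size p));
   rewrite size_polyXn size_poly1.
Qed.

Lemma tb_tqX_neq1 (z : int) : tb * tq ^ z != 1.
Proof.
(* As polynomials in b, the left side has zero constant term, the right side does not. *)
have key i j : tb * tq ^+ i != tq ^+ j.
  rewrite -!tofracXn -tofracM tofrac_eq -!polyC_exp; apply/eqP.
  move=> /(congr1 (fun p : Pbq => p`_0)); rewrite coefXM !coefC /=.
  by move=> /esym/eqP; rewrite expf_eq0 polyX_eq0 andbF.
case: z => i; first by have := key i 0%N; rewrite expr0.
apply/eqP => E; have /eqP := key 0%N i.+1; apply.
by rewrite expr0 mulr1 -[RHS]mul1r -E -mulrA NegzE -exprnN mulVf
  ?mulr1 ?expf_neq0 ?tq_neq0.
Qed.

Lemma spec_a_pa e : spec_a e pa = tq ^ (- e).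
Proof. exact: horner_morphX. Qed.
Lemma spec_a_pb e : spec_a e pb = tb.
Proof. exact: horner_morphC. Qed.
Lemma spec_a_pq e : spec_a e pq = tq.
Proof. exact: horner_morphC. Qed.

Lemma swapXY_pa : swapXY pa = pb.
Proof. exact: swapXY_X. Qed.
Lemma swapXY_pb : swapXY pb = pa.
Proof. exact: swapXY_Y. Qed.
Lemma swapXY_pq : swapXY pq = pq.
Proof. by rewrite /pq swapXY_polyC map_polyC. Qed.

Lemma spec_b_pa e : spec_b e pa = tb.
Proof. by rewrite /= swapXY_pa spec_a_pb. Qed.
Lemma spec_b_pb e : spec_b e pb = tq ^ (- e).
Proof. by rewrite /= swapXY_pb spec_a_pa. Qed.
Lemma spec_b_pq e : spec_b e pq = tq.
Proof. by rewrite /= swapXY_pq spec_a_pq. Qed.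

Lemma spec_a_kernel e f : spec_a e f = 0 -> pdivides (onemq pa e) f.
Proof.
case: e => m f0.
  have [|//|g fE] := linear_kernel Pbq ('X ^+ m)%:P f (tq ^ (- m%:Z)).
    rewrite polyC_exp tofracXn -exprnN mulfV // expf_neq0 ?tq_neq0 //.
  by exists g; rewrite {1}fE /onemq /pq polyC_exp polyC_exp.
(* For e < 0 the value q^(-e) is itself a polynomial, and the factor theorem applies. *)
have : root f ('X ^+ m.+1)%:P.
  rewrite /root -(tofrac_eq0 f.[_]) -horner_map /=.
  by rewrite polyC_exp tofracXn; apply/eqP.
move=> /factor_theorem[g ->]; exists (- g).
by rewrite /onemq /pq /pa !polyC_exp; ring.
Qed.

Lemma spec_b_kernel e f : spec_b e f = 0 -> pdivides (onemq pb e) f.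
Proof.
move=> /spec_a_kernel[g E]; exists (swapXY g).
rewrite -[LHS]swapXYK E rmorphM; congr (_ * _).
by case: e {E} => m; rewrite /onemq rmorphB ?rmorph1 ?rmorphM rmorphXn
  /= ?swapXY_pa swapXY_pq.
Qed.

(** * Divisibility by, and coprimality to, a product of two primes *)

Section PrimeProduct.
Variables (P1 P2 : Pabq) (L1 L2 : fieldType).
Variables (f1 : {rmorphism Pabq -> L1}) (f2 : {rmorphism Pabq -> L2}).
Hypotheses (ker1 : forall F, f1 F = 0 -> pdivides P1 F)
           (ker2 : forall F, f2 F = 0 -> pdivides P2 F).
Hypotheses (f1P1 : f1 P1 = 0) (f2P2 : f2 P2 = 0) (f2P1 : f2 P1 != 0)
           (P2nz : P2 != 0).

Lemma pdivides_prime_product F : f1 F = 0 -> f2 F = 0 -> pdivides (P1 * P2) F.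
Proof.
move=> /ker1[G ->] /eqP; rewrite rmorphM mulf_eq0 (negPf f2P1) /=.
by move=> /eqP/ker2[H ->]; exists H; rewrite mulrA.
Qed.

(** A common divisor [E] lies in neither kernel because [D] does not. Hence both primes divide the
    cofactor of [E] in P1 P2, and cancelling them makes [E] a unit. *)
Lemma pcoprime_prime_product D : f1 D != 0 -> f2 D != 0 ->
  pcoprime D (P1 * P2).
Proof.
move=> D1 D2 E [G DE] [F PE].
have P1nz : P1 != 0 by apply: contraNneq f2P1 => ->; rewrite rmorph0.
have E1 : f1 E != 0 by apply: contraNneq D1 => E0; rewrite DE rmorphM E0 mul0r.
have E2 : f2 E != 0 by apply: contraNneq D2 => E0; rewrite DE rmorphM E0 mul0r.
have [F' FE] : pdivides P1 F.
  apply: ker1; apply/eqP.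
  by rewrite -(mulrI_eq0 _ (mulfI E1)) -rmorphM -PE rmorphM f1P1 mul0r.
have P2E : P2 = E * F' by apply: (mulfI P1nz); rewrite PE FE mulrCA.
have [F'' F'E] : pdivides P2 F'.
  apply: ker2; apply/eqP.
  by rewrite -(mulrI_eq0 _ (mulfI E2)) -rmorphM -P2E f2P2.
apply/unitrPr; exists F''; apply: (mulfI P2nz).
by rewrite mulr1 mulrCA -F'E -P2E.
Qed.
End PrimeProduct.

(** * Modulus and summand under a ring morphism *)

Lemma rmorph_onemq_eq0 (L : fieldType) (f : {rmorphism Pabq -> L}) c e :
  f pq != 0 -> (f (onemq c e) == 0) = (f c * f pq ^ e == 1).
Proof.
move=> q0; case: e => m; rewrite /onemq rmorphB.
  by rewrite rmorph1 rmorphM rmorphXn subr_eq0 eq_sym.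
have qm0 : f pq ^+ m.+1 != 0 by rewrite expf_neq0.
by rewrite rmorphXn subr_eq0 NegzE -exprnN
  -[RHS](inj_eq (mulIf qm0)) mul1r mulfVK // eq_sym.
Qed.

(* The [i]-th factor of [(b q^(d-r); q^d)_k] is multiplied by [q^r] to make it a
   polynomial when [d < r]; [den_term] compensates with [q^(r k)]. *)
Definition num_term (d r k : nat) : Pabq :=
  qpoch (pa * pq ^+ r) (pq ^+ d) k
  * (\prod_(i < k) (pq ^+ r - pb * pq ^+ (d * i.+1)))
  * qpoch (pq ^+ d) (pq ^+ (2 * d)) k * pq ^+ (d * k).

Definition den_term (d r s k : nat) : Pabq :=
  pq ^+ (r * k)
  * (qpoch (pq ^+ d) (pq ^+ d) (k - s) * qpoch (pq ^+ d) (pq ^+ d) (k + s)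
     * qpoch (pa * pb * pq ^+ (2 * d)) (pq ^+ (2 * d)) k).

(** The field is left open: the term is used at the indeterminates in [Fabq] and at their images
    under the specialisations. *)
Definition abq_term {L : fieldType} (a b q : L) (d r s k : nat) : L :=
  (qpoch (a * q ^+ r) (q ^+ d) k
   * qpoch (b * q ^ (d%:Z - r%:Z)) (q ^+ d) k
   * qpoch (q ^+ d) (q ^+ (2 * d)) k * q ^+ (d * k))
  / (qpoch (q ^+ d) (q ^+ d) (k - s)
     * qpoch (q ^+ d) (q ^+ d) (k + s)
     * qpoch (a * b * q ^+ (2 * d)) (q ^+ (2 * d)) k).

Lemma abq_termE (L : fieldType) (a b q : L) d r s k : q != 0 ->
  abq_term a b q d r s k =
  wterm (q ^+ d) (a * q ^+ r) (b * q ^ (d%:Z - r%:Z)) s k.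
Proof.
move=> q0; rewrite /abq_term /wterm.
have -> : a * q ^+ r * (b * q ^ (d%:Z - r%:Z)) * q ^+ d
    = a * b * q ^+ (2 * d).
  rewrite expfzDr // -exprnN -[q ^ d]/(q ^+ d) mul2n -addnn exprD; field.
  by rewrite expf_neq0.
by rewrite (mulnC 2 d) (exprM q d 2) (exprM q d k).
Qed.

Lemma rmorph_term (L : fieldType) (f : {rmorphism Pabq -> L}) d r s k :
  f pq != 0 ->
  f (num_term d r k) / f (den_term d r s k) =
  abq_term (f pa) (f pb) (f pq) d r s k.
Proof.
move=> q0; set t := f pq in q0 *.
have tr0 m : t ^+ m != 0 by rewrite expf_neq0.
have tdr : t ^ (d%:Z - r%:Z) = t ^+ d / t ^+ r.
  by rewrite expfzDr // -exprnN.
rewrite /num_term /den_term /abq_term.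
rewrite !rmorphM !rmorph_qpoch !rmorphM !rmorphXn -/t.
(* Each factor is q^r - b q^(d(i+1)) = q^r (1 - b q^(d-r) q^(d i)). *)
have -> : f (\prod_(i < k) (pq ^+ r - pb * pq ^+ (d * i.+1)))
    = t ^+ (r * k) * qpoch (f pb * t ^ (d%:Z - r%:Z)) (t ^+ d) k.
  rewrite rmorph_prod exprM -[in t ^+ r ^+ k](card_ord k) -prodr_const.
  rewrite -big_split /=.
  apply: eq_bigr => i _; rewrite rmorphB rmorphM !rmorphXn -/t tdr.
  rewrite mulrBr mulr1; congr (_ - _).
  rewrite mulnS exprD exprM; field; exact: tr0.
rewrite -[RHS]mul1r -(divff (tr0 (r * k)%N)) mulf_div; congr (_ / _); ring.
Qed.

(** * The congruence from two generic specialisations *)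

Section Generic.
Variables (L : fieldType) (t b : L).
Hypotheses (t0 : t != 0) (tX : forall i, t ^+ i.+1 != 1).
Hypothesis bt : forall z : int, b * t ^ z != 1.

(** Either specialisation turns ab into the surviving indeterminate, here [b], times a power of q.
    The factors involving ab thus have the form 1 - b t^w, nonzero by [bt]. *)
Lemma den_term_neq0 (f : {rmorphism Pabq -> L}) (z : int) d r s k :
  (0 < d)%N -> f pq = t -> f pa * f pb = b * t ^ z ->
  f (den_term d r s k) != 0.
Proof.
case: d => // d _ fqt fab.
have nz m : qpoch (t ^+ d.+1) (t ^+ d.+1) m != 0.
  by apply: qpoch_neq0 => i; rewrite -exprS -exprM mulSn addSn tX.
rewrite /den_term !rmorphM !rmorph_qpoch !rmorphM !rmorphXn fqt fab.
rewrite !mulf_neq0 ?nz ?expf_neq0 //.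
apply: qpoch_neq0 => i; rewrite -exprM -!mulrA -exprD -[t ^+ _]/(t ^ Posz _).
by rewrite -expfzDr // bt.
Qed.

Lemma sum_wterm_generic (x y : L) (z : int) (d s N M : nat) :
  (0 < d)%N -> x * y = b * t ^ z -> x * t ^+ (d * N) = 1 ->
  odd (N + s) -> (N < M)%N ->
  \sum_(s <= k < M) wterm (t ^+ d) x y s k = 0.
Proof.
case: d => // d _ xy xN oddN ltNM.
apply: (sum_wterm_odd _ _ _ _ _ _ N) => //; rewrite -?exprM //.
- by rewrite expf_neq0.
- by move=> i; rewrite -exprM mulnS addSn tX.
- move=> i; rewrite xy -exprM -mulrA -[t ^+ _]/(t ^ Posz _).
  by rewrite -expfzDr // bt.
Qed.

Lemma sum_term_spec (f : {rmorphism Pabq -> L}) (z : int) (d r s N M : nat) :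
  (0 < d)%N -> f pq = t -> f pa * f pb = b * t ^ z ->
  f pa * t ^+ r * t ^+ (d * N) = 1
    \/ f pb * t ^ (d%:Z - r%:Z) * t ^+ (d * N) = 1 ->
  odd (N + s) -> (N < M)%N ->
  \sum_(s <= k < M) f (num_term d r k) / f (den_term d r s k) = 0.
Proof.
move=> d_gt0 fqt fab fN oddN ltNM.
have fq0 : f pq != 0 by rewrite fqt.
under eq_bigr => k _ do rewrite rmorph_term // abq_termE // fqt.
have xy : f pa * t ^+ r * (f pb * t ^ (d%:Z - r%:Z)) = b * t ^ (z + d).
  rewrite mulrACA fab -[t ^+ r]/(t ^ r%:Z) -!expfzDr // -mulrA -expfzDr //.
  by congr (_ * _ ^ _); ring.
case: fN => fN; first by apply: (sum_wterm_generic _ _ _ _ _ _ _ _ xy fN).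
under eq_bigr => k _ do rewrite wtermC.
by rewrite mulrC in xy; apply: (sum_wterm_generic _ _ _ _ _ _ _ _ xy fN).
Qed.

Lemma abq_sum_congr (f1 f2 : {rmorphism Pabq -> L}) (e1 e2 : int)
    (d r s n alpha beta : nat) :
  e1 = r%:Z + (d * alpha)%N%:Z -> e2 = d%:Z - r%:Z + (d * beta)%N%:Z ->
  f1 pa = t ^ (- e1) -> f1 pb = b -> f1 pq = t ->
  f2 pa = b -> f2 pb = t ^ (- e2) -> f2 pq = t ->
  (forall F, f1 F = 0 -> pdivides (onemq pa e1) F) ->
  (forall F, f2 F = 0 -> pdivides (onemq pb e2) F) ->
  (0 < d)%N -> odd (alpha + s) -> (alpha < n)%N ->
  odd (beta + s) -> (beta < n)%N ->
  congr_mod (\sum_(s <= k < n) abq_term fa fb fq d r s k) 0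
    (onemq pa e1 * onemq pb e2).
Proof.
move=> e1E e2E f1a f1b f1q f2a f2b f2q ker1 ker2 d_gt0 odda ltan oddb ltbn.
have f1ab : f1 pa * f1 pb = b * t ^ (- e1) by rewrite f1a f1b mulrC.
have f2ab : f2 pa * f2 pb = b * t ^ (- e2) by rewrite f2a f2b.
have d1 k := den_term_neq0 f1 _ d r s k d_gt0 f1q f1ab.
have d2 k := den_term_neq0 f2 _ d r s k d_gt0 f2q f2ab.
have f1q0 : f1 pq != 0 by rewrite f1q.
have f2q0 : f2 pq != 0 by rewrite f2q.
have [N sumN] := sum_common_denominator _ (num_term d r) (den_term d r s)
                   (index_iota s n).
set D := \prod_(k <- _) _ in sumN.
have f1D : f1 D != 0.
  by rewrite rmorph_prod prodf_seq_neq0; apply/allP => k _; rewrite d1.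
have f2D : f2 D != 0.
  by rewrite rmorph_prod prodf_seq_neq0; apply/allP => k _; rewrite d2.
have f1N : f1 N = 0.
  have := sumN _ _ d1; rewrite (sum_term_spec f1 (- e1) d r s alpha n) //.
    by move=> /esym/eqP; rewrite mulf_eq0 invr_eq0 (negPf f1D) orbF => /eqP.
  left; rewrite f1a -mulrA -exprD -[t ^+ _]/(t ^ Posz _) -expfzDr // e1E.
  by rewrite PoszD addNr expr0z.
have f2N : f2 N = 0.
  have := sumN _ _ d2; rewrite (sum_term_spec f2 (- e2) d r s beta n) //.
    by move=> /esym/eqP; rewrite mulf_eq0 invr_eq0 (negPf f2D) orbF => /eqP.
  right; rewrite f2b -[t ^+ _]/(t ^ Posz _) -!expfzDr // e2E.
  by rewrite -addrA addNr expr0z.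
set P1 := onemq pa e1 in ker1 *; set P2 := onemq pb e2 in ker2 *.
(* [f2] keeps a generic, so it cannot kill [P1]; likewise [f1] keeps b and cannot kill [P2]. *)
have f2P1 : f2 P1 != 0 by rewrite rmorph_onemq_eq0 // f2q f2a bt.
have P2nz : P2 != 0.
  have : f1 P2 != 0 by rewrite rmorph_onemq_eq0 // f1q f1b bt.
  by apply: contraNneq => ->; rewrite rmorph0.
have f1P1 : f1 P1 = 0.
  by apply/eqP; rewrite rmorph_onemq_eq0 // f1q f1a -expfzDr // addNr expr0z.
have f2P2 : f2 P2 = 0.
  by apply/eqP; rewrite rmorph_onemq_eq0 // f2q f2b -expfzDr // addNr expr0z.
have [C NE] := pdivides_prime_product P1 P2 _ _ f1 f2 ker1 ker2 f2P1 N f1N f2N.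
exists C, D; split; first by apply: contraNneq f1D => ->; rewrite rmorph0.
split; first exact: (pcoprime_prime_product P1 P2 _ _ f1 f2).
rewrite subr0 -tofracM -NE.
have d0 k : tofrac (den_term d r s k) != 0.
  by rewrite tofrac_eq0; apply: contraNneq (d1 k) => ->; rewrite rmorph0.
rewrite -[RHS](sumN _ (@tofrac Pabq : {rmorphism Pabq -> Fabq}) d0).
apply: eq_bigr => k _; apply/esym/rmorph_term.
by rewrite tofrac_eq0 !polyC_eq0 polyX_eq0.
Qed.

End Generic.

(** * The two residues and their parities *)

Theorem theorem1p1 (d n r s : nat) :
  (0 < d)%N -> (0 < n)%N -> (0 < r)%N ->
  coprime d n -> odd n ->
  (s <= n - 1)%N ->
  s = (lnres (- (r%:Q) / d%:Q) n).+1 %[mod 2] ->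
  congr_mod
    (\sum_(s <= k < n)
       (qpoch (fa * fq ^+ r) (fq ^+ d) k
        * qpoch (fb * fq ^ (d%:Z - r%:Z)) (fq ^+ d) k
        * qpoch (fq ^+ d) (fq ^+ (2 * d)) k * fq ^+ (d * k))
       / (qpoch (fq ^+ d) (fq ^+ d) (k - s)
          * qpoch (fq ^+ d) (fq ^+ d) (k + s)
          * qpoch (fa * fb * fq ^+ (2 * d)) (fq ^+ (2 * d)) k))
    0
    ((1 - pa * pq ^+ (r + d * lnres (- (r%:Q) / d%:Q) n))
     * onemq pb (d%:Z - r%:Z + (d * lnres ((r%:Q - d%:Q) / d%:Q) n)%N%:Z)).
Proof.
move=> d_gt0 n_gt0 r_gt0 cdn oddn les.
have -> : - r%:Q = (- r%:Z)%:Q by rewrite rmorphN.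
have -> : r%:Q - d%:Q = (r%:Z - d%:Z)%:Q by rewrite rmorphB.
have [] := lnresP (- r%:Z) d n d_gt0 n_gt0 cdn.
have [] := lnresP (r%:Z - d%:Z) d n d_gt0 n_gt0 cdn.
set alpha := lnres ((- r%:Z)%:Q / _) n; set beta := lnres ((r%:Z - d%:Z)%:Q / _) n.
move=> ltbn dvdb ltan dvda parity.
(* Adding d alpha = -r and d beta = r - d modulo [n] gives n | d (alpha + beta + 1). As [d] is
   coprime to [n] and 0 < alpha + beta + 1 < 2n, the sum is [n]. *)
have ab : (alpha + beta).+1 = n.
  have : (n %| (alpha + beta).+1)%N.
    have := rpredD dvda dvdb.
    have -> : d%:Z * alpha%:Z - - r%:Z + (d%:Z * beta%:Z - (r%:Z - d%:Z))
       = d%:Z * (alpha + beta).+1%:Z by lia.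
    rewrite Gauss_dvdzr; first by rewrite dvdzE.
    by rewrite coprimez_sym.
  move=> /dvdnP[[|[|m]] E]; lia.
have odda : odd (alpha + s).
  by rewrite oddD; move: parity; rewrite !modn2 /=; do 2!case: odd.
have oddb : odd (beta + s).
  by move: odda oddn; rewrite -ab /= !oddD; do 3!case: odd.
(* The exponent r + d alpha is a natural number, so the first factor of the modulus is [onemq pa] at
   it by conversion. *)
apply: (abq_sum_congr _ _ _ tq_neq0 tqX_neq1 tb_tqX_neq1
  (spec_a (r + d * alpha)%N) (spec_b (d%:Z - r%:Z + (d * beta)%N%:Z))
  (r + d * alpha)%N (d%:Z - r%:Z + (d * beta)%N%:Z) d r s n alpha beta) => //.
- exact: spec_a_pa.
- exact: spec_a_pb.
- exact: spec_a_pq.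
- exact: spec_b_pa.
- exact: spec_b_pb.
- exact: spec_b_pq.
- exact: spec_a_kernel.
- exact: spec_b_kernel.
Qed.
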